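(* If $T$ is a tree on $n$ vertices, then $$3-\frac{1}{n}\le \mathrm{aecc}_3(T)\le n-1.$$ The lower bound is achieved when $T\cong K_{1,n-1}$, while the upper bound is achieved when $T\cong P_n$.
   Context: For a connected graph $G$ with $n(G)$ vertices and $S\subseteq V(G)$, the Steiner distance $d_G(S)$ is the minimum number of edges of a connected subgraph of $G$ containing $S$. For $v\in V(G)$, $\mathrm{ecc}_3(v,G)=\max\{d_G(S): v\in S\subseteq V(G), |S|=3\}$, and $\mathrm{aecc}_3(G)=\frac{1}{n(G)}\sum_{v\in V(G)}\mathrm{ecc}_3(v,G)$. $P_n$ is the path on $n$ vertices and $K_{1,n-1}$ the star on $n$ vertices.
   Formalization: The lower bound and its attainment by the star are stated only for n ≥ 4, since for n = 3 the only tree has aecc_3 = 2 < 3 − 1/3; n ≥ 3 is assumed throughout so that ecc_3 is defined. *)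

(* Defs.v *)
From HB Require Import structures.
From mathcomp Require Import all_boot all_order all_algebra.

Set Implicit Arguments.
Unset Strict Implicit.
Unset Printing Implicit Defensive.

Import Order.TTheory GRing.Theory Num.Theory.

Record sgraph := SGraph {
  vertex :> finType;
  adj : rel vertex;
  adj_sym : symmetric adj;
  adj_irr : irreflexive adj }.

Arguments adj {G} x y : rename.

(* All vertices of W are joined by r-paths; the null graph is not connected. *)
Definition connected_on (V : finType) (W : {set V}) (r : rel V) : bool :=
  (W != set0) && [forall x in W, forall y in W, connect r x y].

Definition connected (G : sgraph) : bool := connected_on [set: G] adj.

Definition acyclic (G : sgraph) : Prop :=
  forall c : seq G, 2 < size c -> ~ ucycle adj c.

Definition is_tree (G : sgraph) : Prop := connected G /\ acyclic G.

Definition edges (G : sgraph) : {set {set G}} :=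
  [set A : {set G} | [exists x, exists y, adj x y && (A == [set x; y])]].

(* A pair H = (W, F) stands for the graph with vertex set W and edge set F. *)
Definition is_subgraph (G : sgraph) (H : {set G} * {set {set G}}) : bool :=
  (H.2 \subset edges G) && (cover H.2 \subset H.1).

Definition connected_subgraph (G : sgraph) (H : {set G} * {set {set G}}) : bool :=
  is_subgraph H && connected_on H.1 (fun x y => [set x; y] \in H.2).

(* The default value of the arg min, G itself, satisfies the constraint
   whenever G is connected, so this is the true minimum in that case. *)
Definition steiner_dist (G : sgraph) (S : {set G}) : nat :=
  #|[arg min_(H < ([set: G], edges G) |
       connected_subgraph H && (S \subset H.1)) #|H.2| ].2|.

(* Meaningful for #|G| >= 3; otherwise the maximum is over the empty family. *)
Definition ecc3 (G : sgraph) (v : G) : nat :=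
  \max_(S : {set G} | (v \in S) && (#|S| == 3)) steiner_dist S.

Definition aecc3 (G : sgraph) : rat :=
  (#|G|%:R^-1 * \sum_(v : G) (ecc3 v)%:R)%R.

Definition isomorphic (G H : sgraph) : Prop :=
  exists2 f : G -> H, bijective f & forall x y : G, adj (f x) (f y) = adj x y.

Definition path_adj n : rel 'I_n :=
  fun i j => (i.+1 == j :> nat) || (j.+1 == i :> nat).

Lemma path_adj_sym n : symmetric (@path_adj n).
Proof. by move=> i j; rewrite /path_adj orbC. Qed.

Lemma path_adj_irr n : irreflexive (@path_adj n).
Proof. by move=> i; rewrite /path_adj orbb gtn_eqF. Qed.

Definition path_graph n : sgraph :=
  SGraph (@path_adj_sym n) (@path_adj_irr n).

Definition bip_adj a b : rel ('I_a + 'I_b) :=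
  fun x y => match x, y with
             | inl _, inr _ | inr _, inl _ => true
             | _, _ => false
             end.

Lemma bip_adj_sym a b : symmetric (@bip_adj a b).
Proof. by do 2!case. Qed.

Lemma bip_adj_irr a b : irreflexive (@bip_adj a b).
Proof. by case. Qed.

Definition complete_bipartite a b : sgraph :=
  SGraph (@bip_adj_sym a b) (@bip_adj_irr a b).

(* Main.v *)
(** A connected graph on [k] vertices contains a spanning tree, which has
    [k - 1] edges.  Applied to [T] this bounds every Steiner distance by
    [n - 1]; applied to a connected subgraph [(W, F)] it gives
    [#|W| <= #|F| + 1], so that 3-sets have Steiner distance at least 2, with
    equality only if they induce a connected graph.

    Lower bound: if two vertices [u], [v] had [ecc3 <= 2], then with any other
    [a], [b] all four triples of [{u, v, a, b}] would induce connected graphs,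
    so the non-edges among these four vertices would form a matching and a
    4-cycle would remain.  Hence at most one vertex has eccentricity 2.

    In the path, a connected subgraph containing both end vertices contains all
    vertices, so every eccentricity is [n - 1].  In the star, joining the
    vertices of [S] to the centre [c] shows that the Steiner distance of [S] is
    at most [#|S :\ c|]. *)
Require Import Defs.
From HB Require Import structures.
From mathcomp Require Import all_boot all_order all_algebra.

Set Implicit Arguments.
Unset Strict Implicit.
Unset Printing Implicit Defensive.

Import Order.TTheory GRing.Theory Num.Theory.

(** * Connectivity through edge sets and spanning trees *)

Definition edge_rel (V : finType) (F : {set {set V}}) : rel V :=
  fun x y => [set x; y] \in F.

Lemma edge_rel_sym (V : finType) (F : {set {set V}}) : symmetric (edge_rel F).
Proof. by move=> x y; rewrite /edge_rel setUC. Qed.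

Lemma edge_rel_cover (V : finType) (F : {set {set V}}) (W : {set V}) (x y : V) :
  cover F \subset W -> edge_rel F x y -> (x \in W) && (y \in W).
Proof.
move=> covF xy; apply/andP; split; apply: (subsetP covF); apply/bigcupP.
  by exists [set x; y]; rewrite ?set21.
by exists [set x; y]; rewrite ?set22.
Qed.

(** Take the first step of the path that leaves [A]. The edge found serves to grow trees, to find
    neighbours inside a set and to jump over a missing vertex of a path. *)
Lemma connect_boundary (V : finType) (r : rel V) (A : {set V}) (x y : V) :
    connect r x y -> x \in A -> y \notin A ->
  exists u v, [/\ u \in A, v \notin A & r u v].
Proof.
case/connectP=> p; elim: p x => [|z p IHp] x /=; first by move=> _ -> ->.
case/andP=> rxz pz y_last xA yA; have [zA|zA] := boolP (z \in A).
  exact: IHp pz y_last zA yA.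
by exists x, z.
Qed.

Lemma connected_on_rooted (V : finType) (F : {set {set V}}) (W : {set V}) x :
    x \in W -> (forall y, y \in W -> connect (edge_rel F) x y) ->
  connected_on W (edge_rel F).
Proof.
move=> xW xconn; apply/andP; split; first by apply/set0Pn; exists x.
apply/forall_inP=> y yW; apply/forall_inP=> z zW.
apply: connect_trans (xconn z zW).
by rewrite (sym_connect_sym (@edge_rel_sym _ F)) xconn.
Qed.

(** Prim's construction: start with one vertex and repeatedly add an edge leaving the vertex set
    reached so far. Being connected with one edge fewer than vertices, the result is a tree;
    stopping at any [k] gives the induction. *)
Lemma partial_spanning_tree (V : finType) (F : {set {set V}}) (W : {set V}) k :
    cover F \subset W -> connected_on W (edge_rel F) -> k < #|W| ->
  exists (W' : {set V}) (F' : {set {set V}}),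
    [/\ W' \subset W, F' \subset F, cover F' \subset W', #|W'| = k.+1
     & #|F'| = k /\ connected_on W' (edge_rel F')].
Proof.
move=> covF /andP[/set0Pn[x0 x0W] /forall_inP connW].
elim: k => [_|k IHk ltkW].
  exists [set x0], set0; rewrite sub1set sub0set cards1 cards0 x0W.
  split=> //; first by rewrite /cover big_set0 sub0set.
  split=> //; apply: (@connected_on_rooted _ _ _ x0); first exact: set11.
  by move=> y /set1P->.
have [W' [F' [sW sF covF' cardW' [cardF' connW']]]] := IHk (ltnW ltkW).
have /andP[/set0Pn[x xW'] /forall_inP conn'] := connW'.
have /properP[_ [z zW zW']] : W' \proper W by rewrite properEcard sW cardW'.
have /forall_inP/(_ z zW) xz := connW x (subsetP sW x xW').
have [u [v [uW' vW' uv]]] := connect_boundary xz xW' zW'.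
have /andP[uW vW] := edge_rel_cover covF uv.
(* The edge is new because [v] lies outside [W'], which contains all ends of edges in [F']. *)
have uvF' : [set u; v] \notin F'.
  apply: contra vW' => uv'.
  by have /andP[] := edge_rel_cover covF' (uv' : edge_rel F' u v).
exists (v |: W'), ([set u; v] |: F'); split.
- by rewrite subUset sub1set vW.
- by rewrite subUset sub1set sF andbT.
- apply/bigcupsP=> e /setU1P[->|eF'].
    by rewrite subUset !sub1set setU11 setU1r.
  by apply: subset_trans (subsetUr _ _); apply: subset_trans covF'; apply: bigcup_sup.
- by rewrite cardsU1 vW' cardW'.
split; first by rewrite cardsU1 uvF' cardF'.
have sub' : subrel (connect (edge_rel F')) (connect (edge_rel ([set u; v] |: F'))).
  by apply: connect_sub => a b ab; apply: connect1; apply: setU1r.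
apply: (@connected_on_rooted _ _ _ x); first exact: setU1r.
move=> y /setU1P[->|yW']; last by apply: sub'; have /forall_inP := conn' x xW'; apply.
apply: (@connect_trans _ _ u); last by apply: connect1; apply: setU11.
by apply: sub'; have /forall_inP := conn' x xW'; apply.
Qed.

Lemma connected_card_edges (V : finType) (F : {set {set V}}) (W : {set V}) :
    cover F \subset W -> connected_on W (edge_rel F) -> #|W| <= #|F|.+1.
Proof.
move=> covF connW; have /andP[W0 _] := connW.
(* The largest admissible [k], for which the tree spans [W]. *)
have ltW : (#|W|.-1 < #|W|) by rewrite prednK // card_gt0.
have [W' [F' [_ sF _ cardW' [cardF' _]]]] := partial_spanning_tree covF connW ltW.
by have := subset_leq_card sF; rewrite cardF'; case: #|W|.
Qed.

Lemma extend_to_card (V : finType) (A : {set V}) k :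
  (#|A| <= k <= #|V|) -> exists2 S : {set V}, A \subset S & #|S| = k.
Proof.
case/andP; elim: k => [|k IHk] leAk lekV.
  by exists A => //; apply/eqP; rewrite -leqn0.
move: leAk; rewrite leq_eqVlt ltnS => /orP[/eqP cA|leAk]; first by exists A.
have [S sAS cS] := IHk leAk (ltnW lekV).
have /properP[_ [x _ xS]] : S \proper [set: V].
  by rewrite properEcard subsetT cardsT cS.
by exists (x |: S); rewrite ?cardsU1 ?xS ?cS // subsetU // sAS orbT.
Qed.

(** * Steiner distances of vertex sets *)

Lemma mem_edges (G : sgraph) (x y : G) : ([set x; y] \in edges G) = adj x y.
Proof.
rewrite inE; apply/existsP/idP => [[a /existsP[b /andP[ab /eqP exy]]]|xy]; last first.
  by exists x; apply/existsP; exists y; rewrite xy eqxx.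
have nab : a != b by apply: contraTneq ab => ->; rewrite adj_irr.
have nxy : x != y.
  by have := cards2 x y; rewrite exy cards2 nab; case: eqP.
have: x \in [set a; b] by rewrite -exy set21.
have: y \in [set a; b] by rewrite -exy set22.
move: nxy => /[swap] /set2P[] -> /[swap] /set2P[] ->; rewrite ?eqxx //.
by rewrite adj_sym.
Qed.

Lemma full_connected_subgraph (G : sgraph) :
  connected G -> connected_subgraph ([set: G], edges G).
Proof.
move=> connG; rewrite /connected_subgraph /is_subgraph subxx subsetT /=.
move: connG; rewrite /connected /connected_on; congr (_ && _).
apply: eq_forallb_in => x _; apply: eq_forallb_in => y _.
by apply: eq_connect => a b; rewrite mem_edges.
Qed.

Lemma steiner_dist_witness (G : sgraph) (S : {set G}) : connected G ->
  exists H, [/\ connected_subgraph H, S \subset H.1 & #|H.2| = steiner_dist S].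
Proof.
move=> connG; rewrite /steiner_dist; case: arg_minnP => /=.
  by rewrite full_connected_subgraph // subsetT.
by move=> H /andP[cH sH] _; exists H.
Qed.

Lemma steiner_dist_le (G : sgraph) (S : {set G}) H : connected G ->
  connected_subgraph H -> S \subset H.1 -> steiner_dist S <= #|H.2|.
Proof.
move=> connG cH sH; rewrite /steiner_dist; case: arg_minnP => /=.
  by rewrite full_connected_subgraph // subsetT.
by move=> K _; apply; rewrite cH.
Qed.

Lemma steiner_dist_lower (G : sgraph) (S : {set G}) :
  connected G -> #|S| <= (steiner_dist S).+1.
Proof.
move=> /(steiner_dist_witness S)[[W F] [/andP[/andP[_ covF] connW] sS <-]].
exact: leq_trans (subset_leq_card sS) (connected_card_edges covF connW).
Qed.

Lemma steiner_dist_upper (G : sgraph) (S : {set G}) :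
  connected G -> steiner_dist S <= #|G|.-1.
Proof.
move=> connG.
have /andP[/andP[_ covF] connW] := full_connected_subgraph connG.
have /andP[W0 _] := connW; rewrite -card_gt0 cardsT in W0.
have ltW : (#|G|.-1 < #|[set: G]|) by rewrite cardsT prednK.
have [W [F [_ sF covW cardW [<- connF]]]] := partial_spanning_tree covF connW ltW.
apply: (@steiner_dist_le _ S (W, F)) => //.
  by rewrite /connected_subgraph /is_subgraph sF covW.
suff -> : W = setT by apply: subsetT.
by apply/eqP; rewrite eqEcard subsetT cardW cardsT prednK ?leqnn.
Qed.

Lemma steiner_dist_tight_adj (G : sgraph) (S : {set G}) x :
    connected G -> x \in S -> 1 < #|S| -> ((steiner_dist S).+1 <= #|S|) ->
  exists2 y, y \in S & adj x y.
Proof.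
move=> /(steiner_dist_witness S)[[W F] [/andP[/andP[sF covF] connW] sS <-]].
move: sF covF connW sS => /= sF covF connW sS.
move=> xS S_gt1 leFS.
have eqW : S = W.
  apply/eqP; rewrite eqEcard sS.
  exact: leq_trans (connected_card_edges covF connW) leFS.
have /subsetPn[z zS zx] : ~~ (S \subset [set x]).
  by apply: contraL S_gt1 => /subset_leq_card; rewrite cards1 -leqNgt.
have /andP[_ /forall_inP/(_ x)] := connW; rewrite -eqW => /(_ xS)/forall_inP/(_ z zS) xz.
have [u [v [/set1P-> vx xv]]] := connect_boundary xz (set11 x) zx.
exists v; last by rewrite -mem_edges (subsetP sF).
by rewrite eqW; case/andP: (edge_rel_cover covF (xv : edge_rel F x v)).
Qed.

(** * Vertices of eccentricity at most 2 *)

Lemma steiner_dist_le_ecc3 (G : sgraph) (v : G) (S : {set G}) :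
  v \in S -> #|S| = 3 -> steiner_dist S <= ecc3 v.
Proof. by move=> vS cS; apply: leq_bigmax_cond; rewrite vS cS. Qed.

Lemma ecc3_ge2 (G : sgraph) (v : G) :
  connected G -> 3 <= #|G| -> (2 <= ecc3 v).
Proof.
move=> connG G_ge3; have [|S vS cS] := @extend_to_card _ [set v] 3.
  by rewrite cards1.
rewrite sub1set in vS; apply: leq_trans (steiner_dist_le_ecc3 vS cS).
by have := steiner_dist_lower S connG; rewrite cS.
Qed.

(** Each of [x], [y], [z] has a neighbour among the other two, which gives one disjunction per
    vertex; so at most one of the three pairs is a non-edge. *)
Lemma ecc3_le2_adj (G : sgraph) (v x y z : G) :
    connected G -> ecc3 v <= 2 -> v \in [set x; y; z] ->
    x != y -> x != z -> y != z ->
  [/\ adj x y || adj x z, adj x y || adj y z & adj x z || adj y z].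
Proof.
move=> connG ecc_v vS xy xz yz.
have cS : #|[set x; y; z]| = 3.
  by rewrite setUC cardsU1 cards2 !inE negb_or eq_sym xz eq_sym yz xy.
have leS : ((steiner_dist [set x; y; z]).+1 <= #|[set x; y; z]|).
  by rewrite cS ltnS; apply: leq_trans ecc_v; apply: steiner_dist_le_ecc3.
have nbr w : w \in [set x; y; z] -> [|| adj w x, adj w y | adj w z].
  move=> wS; have [|t] := steiner_dist_tight_adj connG wS _ leS; first by rewrite cS.
  by rewrite !inE => /orP[/orP[]|] /eqP-> ->; rewrite ?orbT.
have := (nbr x, nbr y, nbr z); rewrite !inE !eqxx !orbT !adj_irr /=.
rewrite (adj_sym y x) (adj_sym z x) (adj_sym z y) orbF.
by case=> [[/(_ isT) -> /(_ isT) ->] /(_ isT) ->].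
Qed.

Lemma acyclic_no_C4 (G : sgraph) (a b c d : G) : acyclic G ->
  uniq [:: a; b; c; d] -> ~~ [&& adj a b, adj b c, adj c d & adj d a].
Proof.
move=> acG uniq4; apply/negP=> /and4P[ab bc cd da].
by apply: (acG [:: a; b; c; d]) => //; rewrite /ucycle /= ab bc cd da.
Qed.

Lemma ecc3_le2_unique (G : sgraph) (u v : G) :
    is_tree G -> 4 <= #|G| -> (ecc3 u <= 2) -> ecc3 v <= 2 -> u = v.
Proof.
case=> connG acG G_ge4 ecc_u ecc_v; apply/eqP; apply/negPn/negP=> uv.
have card_uv : #|[set u; v]| = 2 by rewrite cards2 uv.
(* Nested supersets of sizes 3 and 4 supply two further vertices, [a] in [S3] and [b] in [S4]
   outside [S3]. *)
have [|S3 s2 c3] := @extend_to_card _ [set u; v] 3.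
  by rewrite card_uv (ltnW G_ge4).
have [|S4 s3 c4] := @extend_to_card _ S3 4; first by rewrite c3.
have /properP[_ [a aS3]] : [set u; v] \proper S3 by rewrite properEcard s2 card_uv c3.
rewrite !inE negb_or => /andP[au av].
have /properP[_ [b bS4 bS3]] : S3 \proper S4 by rewrite properEcard s3 c3 c4.
have nb w : w \in S3 -> w != b by apply: contraTneq => ->.
have ub : u != b by rewrite nb // (subsetP s2) ?set21.
have vb : v != b by rewrite nb // (subsetP s2) ?set22.
have ab : a != b by apply: nb.
rewrite eq_sym in au; rewrite eq_sym in av.
(* The three triples containing [u] use [ecc_u]; only the triple [v], [a], [b] needs [ecc_v]. *)
have [u1 u2 u3] : [/\ adj u v || adj u a, adj u v || adj v a & adj u a || adj v a].
  by apply: (ecc3_le2_adj connG ecc_u) => //; rewrite !inE eqxx.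
have [v1 v2 v3] : [/\ adj u v || adj u b, adj u v || adj v b & adj u b || adj v b].
  by apply: (ecc3_le2_adj connG ecc_u) => //; rewrite !inE eqxx.
have [w1 w2 w3] : [/\ adj u a || adj u b, adj u a || adj a b & adj u b || adj a b].
  by apply: (ecc3_le2_adj connG ecc_u) => //; rewrite !inE eqxx.
have [x1 x2 x3] : [/\ adj v a || adj v b, adj v a || adj a b & adj v b || adj a b].
  by apply: (ecc3_le2_adj connG ecc_v) => //; rewrite !inE eqxx.
(* These are all the 4-cycles on four vertices, the complements of the three perfect matchings. *)
have c1 : ~~ [&& adj u v, adj v a, adj a b & adj b u].
  by apply: acyclic_no_C4 => //=; rewrite !inE !negb_or uv au ub av vb ab.
have c2 : ~~ [&& adj u a, adj a v, adj v b & adj b u].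
  by apply: acyclic_no_C4 => //=; rewrite !inE !negb_or uv au ub (eq_sym a) av vb ab.
have c5 : ~~ [&& adj u v, adj v b, adj b a & adj a u].
  by apply: acyclic_no_C4 => //=; rewrite !inE !negb_or uv au ub av vb (eq_sym b) ab.
move: c1 c2 c5 u1 u2 u3 v1 v2 v3 w1 w2 w3 x1 x2 x3.
rewrite (adj_sym b u) (adj_sym a v) (adj_sym b a) (adj_sym a u).
(* Six adjacencies remain as booleans; every assignment violates a triple or a cycle condition. *)
by do 6![case: (adj _ _) => //=].
Qed.

(** One vertex may contribute only 2, all others at least 3. The successor on the right avoids a
    truncated subtraction. *)
Lemma sum_ecc3_ge (G : sgraph) :
  is_tree G -> 4 <= #|G| -> (3 * #|G| <= (\sum_(v : G) ecc3 v).+1).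
Proof.
move=> treeG G_ge4; have [connG _] := treeG.
have sum3 (P : pred G) : (\sum_(v | P v) 3 = 3 * #|P|).
  by rewrite sum_nat_const mulnC.
have [/existsP[c ecc_c]|/existsPn ecc_gt2] := boolP [exists v : G, (ecc3 v <= 2)].
  rewrite (bigD1 c) //= -sum3 (bigD1 c) //= -addSn leq_add //.
    by rewrite ltnS ecc3_ge2 // ltnW.
  apply: leq_sum => v vc; rewrite ltnNge; apply: contra vc => ecc_v.
  by apply/eqP; apply: ecc3_le2_unique ecc_v ecc_c.
apply: leqW; rewrite -sum3; apply: leq_sum => v _; by rewrite ltnNge ecc_gt2.
Qed.

(** * Stars and paths *)

Lemma star_steiner_dist (G : sgraph) (c : G) (S : {set G}) : connected G ->
  (forall x, x != c -> adj c x) -> steiner_dist S <= #|S :\ c|.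
Proof.
move=> connG adj_c; set F := [set [set c; x] | x in S :\ c].
apply: (@leq_trans #|F|); last exact: leq_imset_card.
apply: (@steiner_dist_le _ S (c |: S, F)) => //; last exact: subsetUr.
rewrite /connected_subgraph /is_subgraph /= -andbA; apply/and3P; split.
- apply/subsetP=> _ /imsetP[x /setD1P[xc _] ->]; rewrite mem_edges; exact: adj_c.
- apply/bigcupsP=> _ /imsetP[x /setD1P[xc xS] ->].
  by rewrite subUset !sub1set setU11 inE xS orbT.
apply: (@connected_on_rooted _ F _ c); first exact: setU11.
move=> y /setU1P[->//|yS]; have [->//|yc] := eqVneq y c.
by apply: connect1; apply: imset_f; rewrite !inE yc.
Qed.

Lemma star_sum_ecc3 (G : sgraph) (c : G) : connected G ->
  (forall x, x != c -> adj c x) -> \sum_(v : G) ecc3 v < 3 * #|G|.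
Proof.
move=> connG adj_c.
have -> : (3 * #|G| = \sum_(v : G) 3) by rewrite sum_nat_const mulnC.
rewrite (bigD1 c) //= [X in (_ < X)](bigD1 c) //= -addSn leq_add //.
  (* For the centre, [S] contains [c] and two edges suffice; any other vertex is allowed three. *)
  apply/bigmax_leqP=> S /andP[cS /eqP card_S].
  apply: leq_trans (star_steiner_dist S connG adj_c) _.
  by have := cardsD1 c S; rewrite cS card_S add1n => -[<-].
apply: leq_sum => v _; apply/bigmax_leqP=> S /andP[_ /eqP card_S].
apply: leq_trans (star_steiner_dist S connG adj_c) _.
by rewrite -card_S subset_leq_card // subsetDl.
Qed.

Lemma path_steiner_dist n (G : sgraph) (f : G -> 'I_n) (a b : G) (S : {set G}) :
    connected G -> (forall x y, path_adj (f x) (f y) = adj x y) -> injective f ->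
    f a = 0 :> nat -> f b = n.-1 :> nat -> a \in S -> b \in S ->
  (#|G|.-1 <= steiner_dist S).
Proof.
move=> connG f_adj f_inj fa fb aS bS.
have [[W F] [/andP[/andP[sF covF] connW] sS <-]] := steiner_dist_witness S connG.
move: sF covF connW sS => /= sF covF connW sS.
suff eqW : W = setT.
  by have := connected_card_edges covF connW; rewrite eqW cardsT; case: #|G|.
apply/eqP; rewrite -subTset; apply/subsetP=> x _; apply/negPn/negP=> xW.
have /andP[_ /forall_inP/(_ a (subsetP sS a aS))/forall_inP] := connW.
move=> /(_ b (subsetP sS b bS)) conn_ab.
have nfx y : y \in W -> f y != f x :> nat.
  by move=> yW; apply: contraNneq xW => /val_inj/f_inj <-.
have ltb : f x <= f b.
  by rewrite fb -ltnS prednK // (leq_ltn_trans _ (ltn_ord (f x))).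
(* The positions before [f x] include that of [a] but not that of [b]. Since [x] is missing from
   [W], an edge crossing this cut would skip position [f x], but path edges join consecutive
   positions. *)
have [||u [v []]] := @connect_boundary _ _ [set y | (f y < f x)] _ _ conn_ab.
- by rewrite inE fa lt0n eq_sym -fa nfx // (subsetP sS).
- by rewrite inE -leqNgt.
rewrite !inE -leqNgt => ltu lev uv.
have /andP[uW vW] := edge_rel_cover covF (uv : edge_rel F u v).
have: adj u v by rewrite -mem_edges (subsetP sF).
rewrite -f_adj /path_adj => /orP[] /eqP e.
  by have := nfx v vW; rewrite eqn_leq lev -e ltu.
by move: ltu; rewrite -e ltnNge (leq_trans lev) ?leqnSn.
Qed.

Lemma path_ecc3 n (G : sgraph) (v : G) : connected G -> 3 <= #|G| ->
  isomorphic G (path_graph n) -> #|G|.-1 <= ecc3 v.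
Proof.
move=> connG G_ge3 [f f_bij f_adj].
have [g fK gK] := f_bij.
have n_gt0 : (0 < n) by apply: leq_ltn_trans (ltn_ord (f v)).
have lt_n1 : (n.-1 < n) by rewrite prednK.
pose a : G := g (Ordinal n_gt0); pose b : G := g (Ordinal lt_n1).
(* If [v] is an end vertex, the set has only two elements and is enlarged to three. *)
have [|S sS cS] := @extend_to_card _ [set v; a; b] 3.
  by rewrite G_ge3 andbT setUC cardsU1 cards2; case: (_ \notin _); case: (_ != _).
move: sS; rewrite !subUset !sub1set => /andP[/andP[vS aS] bS].
apply: leq_trans (steiner_dist_le_ecc3 vS cS).
apply: (@path_steiner_dist n _ f a b) aS bS => //; try by rewrite gK.
exact: can_inj fK.
Qed.

Lemma ecc3_le (G : sgraph) (v : G) : connected G -> ecc3 v <= #|G|.-1.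
Proof. by move=> connG; apply/bigmax_leqP=> S _; apply: steiner_dist_upper. Qed.

(** * Bounds for the average *)

Local Open Scope ring_scope.

(** For [n = 3] the only 3-set is the whole vertex set, so the average is 2, below 3 - 1/3; hence
    the condition [4 <= n] in the lower bound and in the star case. *)
Theorem theorem5p1 (n : nat) (T : sgraph) (treeT : is_tree T)
    (cardT : #|T| = n) (n_ge3 : (3 <= n)%N) :
  [/\ (4 <= n)%N -> 3 - 1 / n%:R <= aecc3 T,
      aecc3 T <= n%:R - 1,
      (4 <= n)%N -> isomorphic T (complete_bipartite 1 n.-1) ->
        aecc3 T = 3 - 1 / n%:R
    & isomorphic T (path_graph n) -> aecc3 T = n%:R - 1].
Proof.
have [connT _] := treeT.
have n_gt0 : (0 < n)%N by apply: leq_trans n_ge3.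
have n_gt0R : 0 < n%:R :> rat by rewrite ltr0n.
have n_neq0 : n%:R != 0 :> rat by rewrite gt_eqF.
(* Writing every side as a natural number over [n] reduces the claims to the sum of the
   eccentricities. *)
have aeccE : aecc3 T = (\sum_(v : T) ecc3 v)%N%:R / n%:R.
  by rewrite /aecc3 cardT mulrC natr_sum.
have lowE : 3 - 1 / n%:R = (3 * n).-1%:R / n%:R :> rat.
  by rewrite -subn1 natrB ?muln_gt0 // natrM mulrBl mulfK.
have uppE : n%:R - 1 = (\sum_(v : T) n.-1)%N%:R / n%:R :> rat.
  by rewrite sum_nat_const cardT natrM mulrAC divff // mul1r -subn1 natrB.
have lower : (4 <= n)%N -> ((3 * n).-1 <= \sum_(v : T) ecc3 v)%N.
  by move=> n4; have := @sum_ecc3_ge T treeT; rewrite cardT => /(_ n4); case: (3 * n)%N.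
split.
- by move=> n4; rewrite lowE aeccE ler_pM2r ?invr_gt0 // ler_nat lower.
- rewrite uppE aeccE ler_pM2r ?invr_gt0 // ler_nat; apply: leq_sum => v _.
  by rewrite -cardT ecc3_le.
- move=> n4 [f [g fK gK] f_adj]; rewrite lowE aeccE; congr (_%:R / _).
  apply/eqP; rewrite eqn_leq lower // andbT.
  have : (\sum_(v : T) ecc3 v < 3 * #|T|)%N.
    (* The centre is the preimage of the sole vertex on the one-element side. *)
    apply: (@star_sum_ecc3 T (g (inl ord0)) connT) => x xc.
    rewrite -f_adj gK /=; case: (f x) (fK x) => // i gi; move: xc.
    by rewrite -gi (ord1 i) eqxx.
  by rewrite cardT; case: (3 * n)%N.
move=> isoP; rewrite uppE aeccE; congr (_%:R / _); apply: eq_bigr => v _.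
apply/eqP; rewrite eqn_leq -{1}cardT ecc3_le //= -cardT.
by apply: path_ecc3 isoP; rewrite ?cardT.
Qed.
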